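(* Let $d\ge1$, let $\mathcal{A}\subseteq\mathbb{C}$ be finite, let $c \colon \mathbb{R}^d\to\mathcal{A}$ be a Delone configuration of finite local complexity and assume that for all non-zero $\mathbf{w}\in\mathbb{R}^d$ it has an annihilator that has a vertex in direction $\mathbf{w}$. Then $c$ is strongly periodic.
   Context: A set $S\subseteq\mathbb{R}^d$ is uniformly discrete if there is $r>0$ such that every open Euclidean ball of radius $r$ contains at most one point of $S$, and relatively dense if there is $R>0$ such that every closed ball of radius $R$ contains at least one point of $S$. A Delone set is a set that is both. With $B_T$ the closed ball of radius $T$ centered at the origin, let $N_S(T) = |\{ (S-\mathbf{s}) \cap B_T \mid \mathbf{s} \in S \}|$; a Delone set $S$ has finite local complexity if $N_S(T)$ is finite for every $T\ge 0$ (equivalently, $S-S$ is locally finite). A Delone configuration of finite local complexity is a function $c\colon\mathbb{R}^d\to\mathbb{C}$ taking only finitely many values whose support $\{\mathbf{u}\mid c(\mathbf{u})\neq 0\}$ is a Delone set of finite local complexity. An $\mathbb{R}^d$-polynomial is a finitely supported function $f\colon\mathbb{R}^d\to\mathbb{C}$; it is an annihilator of $c$ if $\sum_{\mathbf{v}\in\mathrm{supp}(f)} f(\mathbf{v})\,c(\mathbf{u}-\mathbf{v})=0$ for all $\mathbf{u}\in\mathbb{R}^d$. For non-zero $\mathbf{v}$ let $\overline{H}_{\mathbf{v}}=\{\mathbf{u}\in\mathbb{R}^d\mid \mathbf{u}\cdot\mathbf{v}\le 0\}$ and $\langle\mathbf{v}\rangle^{\perp}=\{\mathbf{u}\in\mathbb{R}^d\mid\mathbf{u}\cdot\mathbf{v}=0\}$.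 A non-empty finite set $F\subseteq\mathbb{R}^d$ has a vertex in direction $\mathbf{v}$ if there is $\mathbf{t}\in\mathbb{R}^d$ such that $F+\mathbf{t}\subseteq\overline{H}_{\mathbf{v}}$ and $(F+\mathbf{t})\cap\langle\mathbf{v}\rangle^{\perp}=\{\mathbf{0}\}$; an $\mathbb{R}^d$-polynomial has a vertex in direction $\mathbf{v}$ if its support is non-empty and has a vertex in direction $\mathbf{v}$. $c$ is strongly periodic if there are $d$ vectors $\mathbf{t}_1,\dots,\mathbf{t}_d$, linearly independent over $\mathbb{R}$, with $c(\mathbf{u}-\mathbf{t}_i)=c(\mathbf{u})$ for all $\mathbf{u}$ and all $i$. *)

(* Defs.v *)
From HB Require Import structures.
From mathcomp Require Import all_boot all_order all_algebra.
From mathcomp Require Import boolp classical_sets functions cardinality fsbigop.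
From mathcomp Require Import reals.
From mathcomp Require Import complex.

Set Implicit Arguments.
Unset Strict Implicit.
Unset Printing Implicit Defensive.

Import Order.TTheory GRing.Theory Num.Theory.
Local Open Scope classical_set_scope.
Local Open Scope ring_scope.
Local Open Scope complex_scope.

Section Delone.
Variables (R : realType) (d : nat).
Implicit Types (u v w s t x : 'rV[R]_d) (S F : set 'rV[R]_d).
Implicit Types (c f : 'rV[R]_d -> R[i]).

Definition dotv u v : R := \sum_(i < d) u 0 i * v 0 i.

(* MathComp-Analysis equips 'rV[R]_d with the sup norm; the balls below are
   Euclidean. *)
Definition enorm u : R := Num.sqrt (dotv u u).

Definition open_eball x (r : R) : set 'rV[R]_d := [set u | enorm (u - x) < r].
Definition closed_eball x (r : R) : set 'rV[R]_d :=
  [set u | enorm (u - x) <= r].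

Definition uniformly_discrete S : Prop :=
  exists2 r : R, 0 < r & forall x, is_subset1 (S `&` open_eball x r).

Definition relatively_dense S : Prop :=
  exists2 r : R, 0 < r & forall x, S `&` closed_eball x r !=set0.

Definition delone S : Prop := uniformly_discrete S /\ relatively_dense S.

Definition patterns S (T : R) : set (set 'rV[R]_d) :=
  [set [set x - s | x in S] `&` closed_eball 0 T | s in S].

Definition finite_local_complexity S : Prop :=
  forall T : R, 0 <= T -> finite_set (patterns S T).

Definition supp f : set 'rV[R]_d := [set u | f u != 0].

Definition delone_configuration_flc c : Prop :=
  [/\ finite_set (range c), delone (supp c)
    & finite_local_complexity (supp c)].

Definition Rd_polynomial f : Prop := finite_set (supp f).

Definition annihilator c f : Prop :=
  Rd_polynomial f /\
  forall u, \sum_(v \in supp f) (f v * c (u - v)) = 0.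

Definition closed_halfspace v : set 'rV[R]_d := [set u | dotv u v <= 0].
Definition orthogonal_hyperplane v : set 'rV[R]_d := [set u | dotv u v = 0].

Definition set_has_vertex F v : Prop :=
  exists t, [set x + t | x in F] `<=` closed_halfspace v /\
    [set x + t | x in F] `&` orthogonal_hyperplane v = [set 0].

Definition has_vertex f v : Prop :=
  supp f !=set0 /\ set_has_vertex (supp f) v.

Definition strongly_periodic c : Prop :=
  exists ts : d.-tuple 'rV[R]_d,
    free ts /\ forall i u, c (u - tnth ts i) = c u.

End Delone.

(* Main.v *)
(** An annihilator with a vertex in direction [-w] expresses [c x] through
    finitely many values [c (x - v)] with [v] strictly on the positive side of
    [w].  The same vectors work for nearby directions, so compactness of
    the unit sphere gives margins that are uniform in [w].  Applied with [w] the
    direction of a point just outside a large enough ball, this shows that the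
    values of [c] on the ball determine [c] on a slightly larger ball, hence
    everywhere.  By finite local complexity only finitely many coloured balls
    occur around the points of the support, and two points with the same
    coloured ball differ by a period.  If all periods were orthogonal to some
    nonzero [w], the function [s |-> s . w] would take only finitely many values
    on the support, contradicting relative density. *)

Require Import Defs.
From HB Require Import structures.
From mathcomp Require Import all_boot all_order all_algebra.
From mathcomp Require Import boolp classical_sets functions cardinality fsbigop.
From mathcomp Require Import reals.
From mathcomp Require Import complex.
From mathcomp Require Import finmap filter topology normedtype.
From mathcomp Require Import ring lra.

Set Implicit Arguments.
Unset Strict Implicit.
Unset Printing Implicit Defensive.

Import Order.TTheory GRing.Theory Num.Theory.
Import numFieldNormedType.Exports.
Local Open Scope classical_set_scope.
Local Open Scope ring_scope.
Local Open Scope complex_scope.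

(** * Euclidean inner product and the unit sphere *)

Section DotProduct.
Variables (R : realType) (d : nat).
Implicit Types u v w : 'rV[R]_d.

Lemma dotvC u v : dotv u v = dotv v u.
Proof. by apply: eq_bigr => i _; rewrite mulrC. Qed.

Lemma dotvDl u v w : dotv (u + v) w = dotv u w + dotv v w.
Proof.
by rewrite /dotv -big_split; apply: eq_bigr => i _; rewrite mxE mulrDl.
Qed.

Lemma dotvZl a u w : dotv (a *: u) w = a * dotv u w.
Proof.
by rewrite /dotv mulr_sumr; apply: eq_bigr => i _; rewrite mxE mulrA.
Qed.

Lemma dotvNl u w : dotv (- u) w = - dotv u w.
Proof. by rewrite -scaleN1r dotvZl mulN1r. Qed.

Lemma dotvDr u v w : dotv w (u + v) = dotv w u + dotv w v.
Proof. by rewrite dotvC dotvDl !(dotvC w). Qed.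

Lemma dotvZr a u w : dotv w (a *: u) = a * dotv w u.
Proof. by rewrite dotvC dotvZl (dotvC w). Qed.

Lemma dotvNr u w : dotv w (- u) = - dotv w u.
Proof. by rewrite dotvC dotvNl (dotvC w). Qed.

Definition dotvE := (dotvDl, dotvDr, dotvZl, dotvZr, dotvNl, dotvNr).

Lemma dotv_ge0 u : 0 <= dotv u u.
Proof. by apply: sumr_ge0 => i _; rewrite -expr2 sqr_ge0. Qed.

Lemma dotvv_eq0 u : (dotv u u == 0) = (u == 0).
Proof.
rewrite /dotv psumr_eq0 => [|i _]; last by rewrite -expr2 sqr_ge0.
apply/allP/eqP => [u0|-> i _]; last by rewrite mxE mul0r eqxx.
apply/rowP => i; rewrite mxE; apply/eqP.
by have := u0 i (mem_index_enum i); rewrite mulf_eq0 orbb.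
Qed.

Lemma dotvv_gt0 u : (0 < dotv u u) = (u != 0).
Proof. by rewrite lt0r dotv_ge0 dotvv_eq0 andbT. Qed.

Lemma sqr_coord_le u i : u 0 i ^+ 2 <= dotv u u.
Proof.
rewrite /dotv (bigD1 i)//= expr2 lerDl.
by apply: sumr_ge0 => j _; rewrite -expr2 sqr_ge0.
Qed.

Lemma enorm_sqr u : enorm u ^+ 2 = dotv u u.
Proof. by rewrite sqr_sqrtr// dotv_ge0. Qed.

Lemma enorm_ge0 u : 0 <= enorm u.
Proof. exact: sqrtr_ge0. Qed.

(** Nonnegativity of the square of [u + w]; it stands in for Cauchy-Schwarz in the final
    estimate. *)
Lemma dotv_lower_bound u w : - (dotv u u + dotv w w) <= dotv u w *+ 2.
Proof. by have := dotv_ge0 (u + w); rewrite !dotvE (dotvC w u); lra. Qed.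

Lemma continuous_sum_mul (I : finType) (f g : I -> 'rV[R]_d -> R) :
  (forall i, continuous (f i)) -> (forall i, continuous (g i)) ->
  continuous (fun u => \sum_i f i u * g i u).
Proof.
move=> fc gc; apply: continuous_big => [|i _ u]; first exact: add_continuous.
exact: (cvgM (fc i u) (gc i u)).
Qed.

Lemma continuous_dotv v : continuous (dotv v).
Proof.
apply: (@continuous_sum_mul _ (fun i _ => v 0 i) (fun i u => u 0 i)) => i.
  exact: cst_continuous.
exact: coord_continuous.
Qed.

Lemma compact_unit_sphere : compact [set u : 'rV[R]_d | dotv u u = 1].
Proof.
have box : compact [set u : 'rV[R]_d | forall i, u ord0 i \in `[(-1), 1 : R]].
  by apply: (@rV_compact R d (fun=> `[(-1), 1 : R]%classic)) => _;
    exact: segment_compact.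
apply: subclosed_compact box _.
  apply: (@closed_comp _ _ (fun u => dotv u u) [set x : R | x = 1]).
    move=> u _.
    apply: (@continuous_sum_mul _ (fun i u => u 0 i) (fun i u => u 0 i));
      exact: coord_continuous.
  exact: closed_eq.
move=> u /= u1 i; have := sqr_coord_le u i; rewrite u1 in_itv/=.
by move=> ?; apply/andP; split; nra.
Qed.

End DotProduct.

(** * Values of [c] determined by values on one side *)

Section Determinism.
Variables (R : realType) (d : nat) (c : 'rV[R]_d -> R[i]).
Implicit Types (u v w x y t : 'rV[R]_d).

Definition determines (vs : seq 'rV[R]_d) : Prop :=
  forall x y, (forall v, v \in vs -> c (x - v) = c (y - v)) -> c x = c y.

(** The coefficient at the vertex [p] is nonzero, so annihilation at [x + p] can be solved for
    [c x]; every other point of the support has a strictly smaller product with [w]. *)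
Lemma vertex_determines f w : annihilator c f -> has_vertex f w ->
  exists2 vs, determines vs & forall v, v \in vs -> dotv v w < 0.
Proof.
move=> [finf ann] [_ [t [tH tV]]].
have [[p fp pt0] _] : ([set x + t | x in supp f] `&` orthogonal_hyperplane w) 0.
  by rewrite tV.
have pE : p = - t by apply/eqP; rewrite -addr_eq0 pt0.
have finf' : finite_set (supp f `\ p) by exact: finite_setD.
exists [seq v - p | v <- fset_set (supp f `\ p)] => [x y xy|_ /mapP[v + ->]].
  have eqn z : f p * c z + \sum_(v \in supp f `\ p) f v * c (z - (v - p)) = 0.
    apply: etrans (ann (z + p)); rewrite [RHS](fsbigD1 p)//= addrK.
    congr (_ + _).
    by apply: eq_fsbigr => v _; rewrite opprB addrA addrAC.
  have := etrans (eqn x) (esym (eqn y)).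
  under eq_fsbigr => v.
    move=> vf; rewrite xy; last by apply: map_f; rewrite in_fset_set.
    over.
  by move=> /addIr; apply: mulfI.
rewrite in_fset_set// => /set_mem[fv /eqP vp].
have vt : [set x + t | x in supp f] (v + t) by exists v.
rewrite pE opprK lt_neqAle tH// andbT; apply: contra vp => /eqP vt0.
have : [set 0] (v + t) by rewrite -tV.
by move/eqP; rewrite addr_eq0 -pE.
Qed.

(** The single parameter [e] bounds the progress of the offsets along [w] from below and their
    length from above; shrinking a positive [e] weakens both conditions. *)
Definition determined_along (w : 'rV[R]_d) (e : R) : Prop :=
  exists2 vs, determines vs
    & forall v, v \in vs -> e <= dotv v w /\ e * dotv v v <= 1.

Lemma near_all_in (I : eqType) (T : Type) (F : set_system T) {FF : Filter F}
    (s : seq I) (P : I -> T -> Prop) :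
  (forall i, i \in s -> \forall x \near F, P i x) ->
  \forall x \near F, forall i, i \in s -> P i x.
Proof.
elim: s => [_|i s IHs sP]; first by near=> x.
have Pi := sP i (mem_head _ _).
have /IHs Ps : forall j, j \in s -> \forall x \near F, P j x.
  by move=> j js; apply: sP; rewrite inE js orbT.
near=> x => j; rewrite inE => /orP[/eqP->|]; first by near: x.
by move: j; near: x.
Unshelve. all: by end_near. Qed.

Lemma determined_along_near w0 vs : determines vs ->
  (forall v, v \in vs -> 0 < dotv v w0) ->
  \forall w \near w0 & e \near 0^'+, determined_along w e.
Proof.
move=> dvs vs0.
suff : \forall we \near filter_prod (nbhs w0) (nbhs (0 : R)^'+),
    forall v, v \in vs -> we.2 <= dotv v we.1 /\ we.2 * dotv v v <= 1.
  by apply: filterS => we vsP; exists vs.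
apply: near_all_in => v /vs0 v0.
have q1 : 0 < 1 + dotv v v by have := dotv_ge0 v; lra.
near=> w e => /=; split.
  apply: (@le_trans _ _ (dotv v w0 / 2)).
    by apply: ltW; near: e; apply: nbhs_right_lt; rewrite divr_gt0.
  apply: ltW; near: w.
  have : dotv v w0 / 2 < dotv v w0 by lra.
  by move=> ?; move: (@continuous_dotv R d v w0) => /cvgr_gt; apply.
have e0 : 0 < e by near: e; exact: nbhs_right_gt.
have : e < (1 + dotv v v)^-1. 
  by near: e; apply: nbhs_right_lt; rewrite invr_gt0.
by rewrite -div1r ltr_pdivlMr// => ?; nra.
Unshelve. all: by end_near. Qed.

Lemma determined_along_uniform :
  (forall w, w != 0 -> exists f, annihilator c f /\ has_vertex f w) ->
  exists2 e : R, 0 < e & forall w, dotv w w = 1 -> determined_along w e.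
Proof.
move=> hann.
(* In this form of compactness, what holds for [w] near each point of the sphere and small [e] holds
   on the whole sphere for small [e]. *)
have /compact_near_coveringP cov := @compact_unit_sphere R d.
have : \forall e \near (0 : R)^'+,
    [set u | dotv u u = 1] `<=` determined_along^~ e.
  apply: (cov _ _ (fun e w => determined_along w e)) => w /= w1.
  have w0 : - w != 0 by rewrite oppr_eq0 -dotvv_gt0 w1.
  have [f [/vertex_determines/[apply] -[vs dvs vsw]]] := hann _ w0.
  apply: (determined_along_near dvs) => v /vsw.
  by rewrite dotvNr oppr_lt0.
move=> H; near (0:R)^'+ => e; exists e; first by near: e; exact: nbhs_right_gt.
by near: e.
Unshelve. all: by end_near. Qed.

Definition agree_on_ball x y (T : R) : Prop :=
  forall u, enorm u <= T -> c (x + u) = c (y + u).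

(** Let [n = |u| > T] and take offsets [v] for the direction [u / n]. Then [v.u >= e n] and
    [|v|^2 <= 1 / e <= e T <= e n], so [|u - v|^2 <= n^2 - e n]. This is at most [T^2] because
    [n <= T + e / 2]. *)
Lemma agree_on_ball_extend (e T : R) x y : 0 < e ->
  (forall w, dotv w w = 1 -> determined_along w e) -> (e ^+ 2)^-1 <= T ->
  agree_on_ball x y T -> agree_on_ball x y (T + e / 2).
Proof.
move=> e0 det Tge xy u uT.
have [/xy//|Tu] := leP (enorm u) T.
have T0 : 0 < T by apply: lt_le_trans Tge; rewrite invr_gt0 exprn_gt0.
have u0 : 0 < enorm u by exact: lt_trans Tu.
have [|vs dvs vsP] := det ((enorm u)^-1 *: u).
  by rewrite !dotvE -enorm_sqr; field; rewrite gt_eqF.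
apply: dvs => v /vsP[]; rewrite dotvZr mulrC ler_pdivlMr// => ve v1.
rewrite -!addrA; apply: xy.
rewrite -(@ler_pXn2r _ 2)// ?nnegrE ?enorm_ge0 ?(ltW T0)// enorm_sqr.
rewrite !dotvE -(enorm_sqr u) (dotvC u v).
have eT : 1 <= e ^+ 2 * T by rewrite mulrC -ler_pdivrMr ?exprn_gt0// mul1r.
set n := enorm u in u0 Tu uT ve *.
set q := dotv v v in v1 *; set p := dotv v u in ve *.
have qn : q <= e * n.
  by rewrite -(ler_pM2l e0); apply: (le_trans v1); apply: (le_trans eT); nra.
by nra.
Qed.

Lemma agree_on_ball_forever (e : R) x y : 0 < e ->
  (forall w, dotv w w = 1 -> determined_along w e) ->
  agree_on_ball x y (e ^+ 2)^-1 -> forall u, c (x + u) = c (y + u).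
Proof.
move=> e0 det xy u.
have xyn n : agree_on_ball x y ((e ^+ 2)^-1 + n%:R * (e / 2)).
  elim: n => [|n IHn]; first by rewrite mul0r addr0.
  rewrite -natr1 mulrDl mul1r addrA; apply: agree_on_ball_extend => //.
  by rewrite lerDl mulr_ge0// divr_ge0// ltW.
have e20 : 0 < e / 2 by rewrite divr_gt0.
have e2V0 : 0 <= (e ^+ 2)^-1 by rewrite invr_ge0 exprn_ge0// ltW.
(* Each extension gains the same [e / 2], so this many of them reach [u]. *)
apply: (xyn (Num.truncn (enorm u / (e / 2))).+1).
have := truncnS_gt (enorm u / (e / 2)).
by rewrite ltr_pdivrMr//; lra.
Qed.

End Determinism.

(** * Finiteness of images and of colourings *)

Lemma finite_image_factor (T : choiceType) (U V : Type) (k : T -> U)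
    (f : T -> V) (D : set T) :
  (forall x y, D x -> D y -> k x = k y -> f x = f y) ->
  finite_set (k @` D) -> finite_set (f @` D).
Proof.
move=> kf kfin; have [->|/set0P[x0 _]] := eqVneq D set0.
  by rewrite image_set0.
(* On [D], [f] is [g] after [k]; [x0] is only the default for values [b] not attained on [D]. *)
pose g b := f (xget x0 [set x | D x /\ k x = b]).
apply: sub_finite_set (finite_image g kfin) => _ [x Dx <-].
exists (k x); first by exists x.
by rewrite /g; case: xgetP => [y _ [Dy kyx]|/(_ x)[]//]; exact: kf.
Qed.

Lemma finite_set_maps (T U : Type) (A : set U) (l : seq T) : finite_set A ->
  finite_set [set map g l | g in [set g | range g `<=` A]].
Proof.
move=> finA; elim: l => [|x l IHl].
  by apply: sub_finite_set (finite_set1 [::]) => _ [g _ <-].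
apply: sub_finite_set (finite_image2 cons finA IHl) => _ [g gA <-] /=.
by exists (g x); [apply: gA; exists x | exists (map g l) => //; exists g].
Qed.

(** * Finitely many coloured patches *)

Section Patches.
Variables (R : realType) (d : nat).
Implicit Types (u v w x y s t : 'rV[R]_d) (S : set 'rV[R]_d).

Lemma coord_le_enorm u i : `|u 0 i| <= enorm u.
Proof. by rewrite -sqrtr_sqr ler_sqrt ?dotv_ge0// sqr_coord_le. Qed.

(* The ball is cut into cubes so small that each meets S at most once. *)
Lemma uniformly_discrete_finite S s (T : R) :
  uniformly_discrete S -> finite_set (S `&` closed_eball s T).
Proof.
(* Cubes of side [r / (d + 1)] have diagonal strictly below [r], also for [d = 1], where side
   [r / d] would only give [r]. *)
move=> [r r0 Sr]; pose K := d.+1%:R / r.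
pose cell x := [ffun i : 'I_d =>
  inord (Num.truncn (((x - s) 0 i + T) * K)) : 'I_(Num.truncn (2 * T * K)).+1].
rewrite -(image_id (S `&` _)).
apply: (@finite_image_factor _ _ _ cell) => [x y [Sx xT] [Sy yT] xy|];
  last exact: finite_finset.
have K0 : 0 < K by rewrite divr_gt0 ?ltr0n.
(* Adding [T] makes the coordinates nonnegative for [truncn], and the upper bound keeps [inord]
   within range. *)
have bnd z i : closed_eball s T z -> 0 <= ((z - s) 0 i + T) * K <= 2 * T * K.
  move=> zT; have := le_trans (coord_le_enorm (z - s) i) zT.
  rewrite ler_norml => /andP[z1 z2].
  by rewrite mulr_ge0 ?(ltW K0)//= ?ler_wpM2r ?(ltW K0)//; lra.
have close i : (y - x) 0 i ^+ 2 <= (K ^+ 2)^-1.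
  have /andP[x0 xN] := bnd x i xT; have /andP[y0 yN] := bnd y i yT.
  have := congr1 val (congr1 (fun h : {ffun _} => h i) xy).
  rewrite !ffunE /= !inordK ?ltnS ?le_truncn// => txy.
  have /andP[x1 x2] := truncn_itv x0; have /andP[y1 y2] := truncn_itv y0.
  rewrite txy -?natr1 in x1 x2 y1 y2.
  rewrite -div1r ler_pdivlMr ?exprn_gt0// -exprMn.
  have -> : (y - x) 0 i = (y - s) 0 i - (x - s) 0 i by rewrite !mxE; ring.
  rewrite (_ : _ * K = ((y - s) 0 i + T) * K - ((x - s) 0 i + T) * K);
    last by ring.
  move: (_ * K) (_ * K) x1 x2 y1 y2 => a b a1 a2 b1 b2.
  by nra.
apply: (Sr x); split=> //; rewrite /open_eball/= /enorm.
  by rewrite subrr (eqP (_ : dotv 0 0 == 0)) ?dotvv_eq0// sqrtr0.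
rewrite -(ltr_pXn2r (n := 2))// ?nnegrE ?sqrtr_ge0 ?(ltW r0)// enorm_sqr.
apply: (@le_lt_trans _ _ (\sum_(i < d) (K ^+ 2)^-1)).
  by apply: ler_sum => i _; rewrite -expr2.
rewrite sumr_const card_ord -mulr_natr mulrC ltr_pdivrMr ?exprn_gt0//.
rewrite /K expr_div_n mulrC divfK ?expf_neq0 ?gt_eqF// -natrX ltr_nat.
by rewrite -[X in (X < _)%N]expn1 (leq_trans (_ : _ < d.+1 ^ 1)%N)// leq_pexp2l.
Qed.

(** There are finitely many patch shapes by finite local complexity; each is a finite set of points
    and admits finitely many colourings. *)
Lemma finite_colored_patches (V : Type) (c : 'rV[R]_d -> R[i])
    (f : 'rV[R]_d -> V) (T : R) : 0 <= T ->
  delone_configuration_flc c ->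
  (forall x y, agree_on_ball c x y T -> f x = f y) ->
  finite_set (f @` supp c).
Proof.
move=> T0 [finc [ud _] flc] fc.
pose patch s := [set x - s | x in supp c] `&` closed_eball 0 T.
apply: (@sub_finite_set _ _ (\bigcup_(P in patterns (supp c) T)
    f @` (supp c `&` [set s | patch s = P]))) => [_ [s cs <-]|].
  by exists (patch s); [exists s | exists s].
apply: bigcup_finite => [|_ [s0 cs0 <-]]; first exact: flc.
have /finite_seqP[l lE] : finite_set (patch s0).
  apply: sub_finite_set (finite_image (fun x => x - s0)
    (uniformly_discrete_finite s0 T ud)) => _ [[x cx <-] xT].
  by exists x => //; split=> //; move: xT; rewrite /closed_eball/= subr0.
apply: (@finite_image_factor _ _ _ (fun s => [seq c (s + u) | u <- l])).
  move=> x y [cx xP] [cy yP] /eq_in_map xy; apply: fc => u uT.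
  have [/xy//|ul] := boolP (u \in l).
  (* Off the listed patch [c] vanishes, so agreement on [l] is agreement on the whole ball. *)
  have outside z : patch z = patch s0 -> c (z + u) = 0.
    move=> zP; apply/eqP; apply: contraNT ul => czu.
    suff : [set` l] u by [].
    rewrite -lE -zP; split; last by rewrite /closed_eball/= subr0.
    by exists (z + u) => //; rewrite addrC addKr.
  by rewrite !outside.
apply: sub_finite_set (finite_set_maps l finc) => _ [s _ <-].
by exists (fun u => c (s + u)) => // _ [u _ <-]; exists (s + u).
Qed.

(** * Free families from vectors avoiding each hyperplane *)

Lemma dotv_span (k : nat) (X : k.-tuple 'rV[R]_d) w t :
  (forall i, dotv (tnth X i) w = 0) -> t \in <<X>>%VS -> dotv t w = 0.
Proof.
move=> Xw /coord_span ->.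
elim/big_rec: _ => [|i z _ zw].
  by rewrite /dotv big1// => i _; rewrite mxE mul0r.
by rewrite !dotvE zw addr0 -tnth_nth Xw mulr0.
Qed.

(** With the vectors as columns, a [d] by [k] matrix has rank below [d], hence a nonzero left
    kernel. *)
Lemma exists_orthogonal (k : nat) (X : k.-tuple 'rV[R]_d) : (k < d)%N ->
  exists2 w, w != 0 & forall i, dotv (tnth X i) w = 0.
Proof.
move=> kd; pose M : 'M[R]_(d, k) := \matrix_(i, j) tnth X j 0 i.
have : kermx M != 0.
  by rewrite kermx_eq0 /row_free neq_ltn (leq_ltn_trans (rank_leq_col M) kd).
move=> /rowV0Pn[w /sub_kermxP wM w0]; exists w => // j.
have := congr1 (fun N : 'rV_k => N 0 j) wM; rewrite !mxE => <-.
by rewrite dotvC; apply: eq_bigr => i _; rewrite mxE.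
Qed.

(** Extend a free family one vector at a time: with [w] orthogonal to the family, a vector not
    orthogonal to [w] lies outside its span. *)
Lemma free_of_not_in_hyperplane (P : set 'rV[R]_d) :
  (forall w, w != 0 -> exists2 t, P t & dotv t w != 0) ->
  exists2 ts : d.-tuple 'rV[R]_d, free ts & forall i, P (tnth ts i).
Proof.
move=> hP.
suff H k : (k <= d)%N -> exists2 ts : k.-tuple 'rV[R]_d, free ts &
    forall i, P (tnth ts i).
  exact: H.
elim: k => [_|k IHk kd]; first by exists [tuple] => [|[]//]; rewrite nil_free.
have [ts tsf tsP] := IHk (ltnW kd).
have [w w0 tsw] := exists_orthogonal ts kd.
have [t Pt tw] := hP w w0.
exists [tuple of t :: ts] => [|i].
  by rewrite free_cons tsf andbT; apply: contra tw => /(dotv_span tsw)->.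
case: (unliftP ord0 i) => [j|] ->; last by rewrite tnth0.
by rewrite tnthS.
Qed.

End Patches.

(** * Periods outside every hyperplane *)

Theorem theorem7p4 (R : realType) (d : nat) (hd : (1 <= d)%N)
    (A : set R[i]) (hA : finite_set A)
    (c : 'rV[R]_d -> R[i]) (hcA : range c `<=` A)
    (hc : delone_configuration_flc c)
    (hann : forall w : 'rV[R]_d, w != 0 ->
       exists f : 'rV[R]_d -> R[i], annihilator c f /\ has_vertex f w) :
  strongly_periodic c.
Proof.
suff [ts tsf tsc] : exists2 ts : d.-tuple 'rV[R]_d, free ts &
    forall i, [set t | forall u, c (u - t) = c u] (tnth ts i) by exists ts.
apply: free_of_not_in_hyperplane => w w0.
apply: contrapT => noper.
have per0 t : (forall u, c (u - t) = c u) -> dotv t w = 0.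
  by move=> ct; apply/eqP; apply: contrapT => /negP tw; apply: noper; exists t.
have [e e0 det] := determined_along_uniform hann.
(* Equal coloured balls at [x] and [y] make [x - y] a period, hence orthogonal to [w]. *)
have fin : finite_set [set dotv s w | s in supp c].
  apply: (@finite_colored_patches _ _ _ _ _ (e ^+ 2)^-1) => // [|x y xy].
    by rewrite invr_ge0 exprn_ge0// ltW.
  have /eqP : dotv (x - y) w = 0.
    apply: per0 => u; rewrite opprB addrCA.
    have := agree_on_ball_forever e0 det xy (u - x).
    by rewrite [x + _]addrC subrK.
  by rewrite dotvDl dotvNl subr_eq0 => /eqP.
have [M HM] : exists M, forall s, supp c s -> dotv s w <= M.
  have /finite_seqP[l lE] := fin.
  exists (\sum_(x <- l) `|x|) => s cs.
  have : [set` l] (dotv s w) by rewrite -lE; exists s.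
  move=> /= sl; rewrite (big_rem _ sl)/=.
  by rewrite (le_trans (ler_norm _))// lerDl sumr_ge0.
have [_ [_ [r r0 rd]] _] := hc.
have q0 : 0 < dotv w w by rewrite dotvv_gt0.
(* Chosen so that any [s] within [r] of [lam *: w] has
   [s.w >= lam |w|^2 - (r^2 + |w|^2) / 2 > M]. *)
pose lam := (M + r ^+ 2 + dotv w w + 1) / dotv w w.
have lamE : lam * dotv w w = M + r ^+ 2 + dotv w w + 1 by rewrite divfK ?gt_eqF.
have [s [cs sr]] := rd (lam *: w).
have := HM s cs; rewrite -[s in dotv s w](subrK (lam *: w)) dotvDl dotvZl lamE.
have := dotv_lower_bound (s - lam *: w) w.
have : dotv (s - lam *: w) (s - lam *: w) <= r ^+ 2.
  by rewrite -enorm_sqr ler_pXn2r// nnegrE ?enorm_ge0// ltW.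
have := sqr_ge0 r.
lra.
Qed.
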